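(* Consider the trace-limited scheme $u_h^n\mapsto u_h^{n+1}$ described in the context (with predictor operator $\mathcal H=\mathcal F$ or $\mathcal H=\mathcal G$) for the scalar conservation law $u_t+f(u)_x=0$ in one space dimension with periodic or compactly supported boundary conditions, on a uniform mesh of cell size $h$, with the TVD limiter, i.e. $M=0$. Assume that the corrector weights satisfy $b_\ell\ge 0$ for $\ell=1,\dots,s$ and $\sum_{\ell=1}^s b_\ell=1$, and that the monotone numerical flux $\widehat f$ has Lipschitz constants $L_1$ and $L_2$ in its first and second arguments, respectively. Let $\lambda=\Delta t/h$. If $\lambda\le \dfrac{1}{2(L_1+L_2)}$, then $$\mathrm{TVM}(u_h^{n+1})\le \mathrm{TVM}(u_h^n).$$
   Context: **Mesh and spaces.** $\{I_i\}_{i=1}^N$, $I_i=[x_{i-1/2},x_{i+1/2}]$, is a uniform partition of the domain $\Omega$ with cell size $h$ (so $h_i\equiv h$). $\mathbb V_h^k$ is the space of functions $v\in L^2(\Omega)$ whose restriction to each $I_i$ is a polynomial of degree at most $k$. For $v\in\mathbb V_h^k$, $v_{i+1/2}^{\pm}=\lim_{\delta\to0^+}v(x_{i+1/2}\pm\delta)$ and $\overline v_i=\frac1{h}\int_{I_i}v\,dx$. A piecewise constant function $\overline q\in\mathbb V_h^0$ is identified with its cell values $\overline q_i$; $\overline u_h$ denotes the piecewise constant function of cell averages of $u_h$. $\Delta_+\overline v_i=\overline v_{i+1}-\overline v_i$, $\Delta_-\overline v_i=\overline v_i-\overline v_{i-1}$. Indices are extended periodically, or (compactly supported case) all functions vanish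 near and beyond the boundary. The total variation in the means is $\mathrm{TVM}(v)=\sum_i|\overline v_{i+1}-\overline v_i|$. **Numerical flux.** $\widehat f(\cdot,\cdot)$ is consistent ($\widehat f(u,u)=f(u)$), monotone (nondecreasing in its first argument, nonincreasing in its second), and Lipschitz continuous in each argument. **DG operators.** $\mathcal F,\mathcal G:\mathbb V_h^k\to\mathbb V_h^k$ are defined by requiring, for all $\phi\in\mathbb V_h^k$ and all $i$, $$\int_{I_i}\mathcal F(v)\phi\,dx=\int_{I_i}f(v)\phi_x\,dx-\big[\widehat f(v_{i+1/2}^-,v_{i+1/2}^+)\phi_{i+1/2}^--\widehat f(v_{i-1/2}^-,v_{i-1/2}^+)\phi_{i-1/2}^+\big],$$ $$\int_{I_i}\mathcal G(v)\phi\,dx=\int_{I_i}f(v)\phi_x\,dx-\big[f(v_{i+1/2}^-)\phi_{i+1/2}^--f(v_{i-1/2}^+)\phi_{i-1/2}^+\big].$$ For a collection of double-valued traces $\widetilde v=\{\widetilde v_{i-1/2}^+,\widetilde v_{i+1/2}^-\}_i$, $\mathcal F(v;\widetilde v)\in\mathbb V_h^k$ is defined by $$\int_{I_i}\mathcal F(v;\widetilde v)\phi\,dx=\int_{I_i}f(v)\phi_x\,dx-\big[\widehat f(\widetilde v_{i+1/2}^-,\widetilde v_{i+1/2}^+)\phi_{i+1/2}^--\widehat f(\widetilde v_{i-1/2}^-,\widetilde v_{i-1/2}^+)\phi_{i-1/2}^+\big].$$ **Minmod.** $m(a,b,c)=\sigma\min\{|a|,|b|,|c|\}$ if $\operatorname{sgn}a=\operatorname{sgn}b=\operatorname{sgn}c=\sigma$,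 and $m(a,b,c)=0$ otherwise. For $M\ge0$, $\widetilde m(a,b,c;M,h)=a$ if $|a|\le Mh^2$, and $\widetilde m(a,b,c;M,h)=m(a,b,c)$ otherwise. **Trace limiter.** For $v\in\mathbb V_h^k$ and reference averages $\overline q\in\mathbb V_h^0$, $\widetilde v=\Lambda_{\mathrm{tr}}(v;\overline q)$ is the collection of traces $$\widetilde v_{i+1/2}^-=\overline q_i+\widetilde m(v_{i+1/2}^--\overline q_i,\Delta_+\overline q_i,\Delta_-\overline q_i;M,h),\qquad \widetilde v_{i-1/2}^+=\overline q_i-\widetilde m(\overline q_i-v_{i-1/2}^+,\Delta_+\overline q_i,\Delta_-\overline q_i;M,h).$$ **Polynomial limiter.** $\Lambda:\mathbb V_h^k\to\mathbb V_h^k$: given $w$, let $\widetilde w=\Lambda_{\mathrm{tr}}(w;\overline w)$. On a cell $I_i$ where neither evaluation of $\widetilde m$ modifies its first argument, $\Lambda(w)|_{I_i}=w|_{I_i}$. Otherwise $\Lambda(w)|_{I_i}$ is the unique polynomial of degree at most $\min(k,2)$ on $I_i$ with cell average $\overline w_i$, right-end inner trace $\widetilde w_{i+1/2}^-$ and left-end inner trace $\widetilde w_{i-1/2}^+$. **Trace-limited scheme.** Let $A=(a_{\ell j})$, $b=(b_\ell)$ be the Butcher coefficients of an explicit $s$-stage Runge–Kutta method ($a_{\ell j}=0$ for $j\ge\ell$). Given $u_h^n\in\mathbb V_h^k$ and a fixed choice $\mathcal H\in\{\mathcal F,\mathcal G\}$, define $$u_h^{(\ell)}=u_h^n+\Delta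 t\sum_{j=1}^{\ell-1}a_{\ell j}\mathcal H(u_h^{(j)}),\qquad \widetilde u_h^{(\ell)}=\Lambda_{\mathrm{tr}}(u_h^{(\ell)};\overline u_h^n),\qquad \ell=1,\dots,s,$$ $$w_h^{n+1}=u_h^n+\Delta t\sum_{\ell=1}^s b_\ell\,\mathcal F(u_h^{(\ell)};\widetilde u_h^{(\ell)}),\qquad u_h^{n+1}=\Lambda(w_h^{n+1}).$$ *)

(* Defs.v *)
From HB Require Import structures.
From mathcomp Require Import all_boot all_order all_algebra.
From mathcomp Require Import all_classical all_reals all_analysis.
Set Implicit Arguments.
Unset Strict Implicit.
Unset Printing Implicit Defensive.
Import Order.TTheory GRing.Theory Num.Theory.
Import numFieldNormedType.Exports.
Local Open Scope classical_set_scope.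
Local Open Scope ring_scope.

(* Functions on Omega are extended to the whole line by the boundary
   condition, so cells are indexed by int and Omega is the union of the cells
   1, ..., N.  An interface x_{i+1/2} is indexed by the integer i. *)
Record mesh (R : realType) := Mesh {
  left_end : R;
  cell_size : R;
  ncells : nat;
  cell_size_gt0 : 0 < cell_size;
  ncells_gt0 : (0 < ncells)%N }.

Section DG.
Context {R : realType} (T : mesh R).
Local Notation h := (cell_size T).
Local Notation N := (ncells T).
Local Notation mu := (@lebesgue_measure R).

(* x_{i+1/2} *)
Definition interface (i : int) : R := left_end T + i%:~R * h.
Definition right_end : R := interface N%:Z.

(* I_i and its interior *)
Definition cell (i : int) : set R := `[interface (i - 1), interface i].
Definition cell_int (i : int) : set R := `]interface (i - 1), interface i[.

(* Elements of V_h^k are double valued at the interfaces, so values there are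
   never prescribed nor compared. *)
Definition eqV (v w : R -> R) : Prop :=
  forall i x, cell_int i x -> v x = w x.

Definition Vh (k : nat) : set (R -> R) := [set v | forall i : int,
  exists p : {poly R}, (size p <= k.+1)%N /\
    forall x, cell_int i x -> v x = p.[x]].

Inductive boundary_condition := Periodic | CompactSupport.

Definition satisfies_bc (bc : boundary_condition) (v : R -> R) : Prop :=
  match bc with
  | Periodic => eqV (fun x => v (x + N%:R * h)) v
  | CompactSupport => exists2 delta : R, 0 < delta &
      forall i x, cell_int i x ->
        x < left_end T + delta \/ right_end - delta < x -> v x = 0
  end.

Definition Vh_bc (k : nat) (bc : boundary_condition) : set (R -> R) :=
  Vh k `&` satisfies_bc bc.

(* v_{i+1/2}^- and v_{i+1/2}^+ *)
Definition trace_minus (v : R -> R) (i : int) : R :=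
  lim (v x @[x --> (interface i)^'-]).
Definition trace_plus (v : R -> R) (i : int) : R :=
  lim (v x @[x --> (interface i)^'+]).

Record traces := Traces { tminus : int -> R; tplus : int -> R }.
Definition own_traces (v : R -> R) : traces :=
  Traces (trace_minus v) (trace_plus v).

Definition average (v : R -> R) (i : int) : R :=
  h^-1 * \int[mu]_(x in cell i) v x.

(* In the compactly supported case the terms outside this range vanish. *)
Definition TVM (v : R -> R) : R :=
  \sum_(1 <= i < N.+1) `|average v (i%:Z + 1) - average v i%:Z|.

Definition consistent (f : R -> R) (fhat : R -> R -> R) : Prop :=
  forall u, fhat u u = f u.

Definition monotone_flux (fhat : R -> R -> R) : Prop :=
  (forall v, {homo fhat^~ v : x y / x <= y}) /\
  (forall u, {homo fhat u : x y /~ x <= y}).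

Definition lipschitz_flux (L1 L2 : R) (fhat : R -> R -> R) : Prop :=
  (forall v, L1.-lipschitz (fhat^~ v)) /\ (forall u, L2.-lipschitz (fhat u)).

(* g is the element of V_h^k determined by the DG weak form for f(v), with
   outgoing flux Fr i at the right end and Fl i at the left end of I_i. *)
Definition DG_weak_form (k : nat) (bc : boundary_condition) (f : R -> R)
    (Fr Fl : int -> R) (v g : R -> R) : Prop :=
  Vh_bc k bc g /\
  forall phi, Vh k phi -> forall i : int, 1 <= i <= N%:Z ->
    \int[mu]_(x in cell i) (g x * phi x) =
    \int[mu]_(x in cell i) (f (v x) * derive1 phi x) -
      (Fr i * trace_minus phi i - Fl i * trace_plus phi (i - 1)).

(* g = F(v; vt) *)
Definition is_F_traces k bc f (fhat : R -> R -> R) (v : R -> R) (vt : traces)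
    (g : R -> R) : Prop :=
  DG_weak_form k bc f (fun i => fhat (tminus vt i) (tplus vt i))
    (fun i => fhat (tminus vt (i - 1)) (tplus vt (i - 1))) v g.

(* g = F(v) *)
Definition is_F k bc f fhat (v g : R -> R) : Prop :=
  is_F_traces k bc f fhat v (own_traces v) g.

(* g = G(v) *)
Definition is_G k bc f (v g : R -> R) : Prop :=
  DG_weak_form k bc f (fun i => f (trace_minus v i))
    (fun i => f (trace_plus v (i - 1))) v g.

Inductive predictor := PredictorF | PredictorG.

Definition is_predictor (H : predictor) k bc f fhat (v g : R -> R) : Prop :=
  match H with
  | PredictorF => is_F k bc f fhat v g
  | PredictorG => is_G k bc f v g
  end.

Definition minmod (a b c : R) : R :=
  if (Num.sg a == Num.sg b) && (Num.sg b == Num.sg c)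
  then Num.sg a * Num.min `|a| (Num.min `|b| `|c|) else 0.

Definition minmodM (M : R) (a b c : R) : R :=
  if `|a| <= M * h ^+ 2 then a else minmod a b c.

Definition Delta_plus (q : int -> R) (i : int) : R := q (i + 1) - q i.
Definition Delta_minus (q : int -> R) (i : int) : R := q i - q (i - 1).

(* The two evaluations of the modified minmod on I_i. *)
Definition limited_right (M : R) (v : R -> R) (q : int -> R) (i : int) : R :=
  minmodM M (trace_minus v i - q i) (Delta_plus q i) (Delta_minus q i).
Definition limited_left (M : R) (v : R -> R) (q : int -> R) (i : int) : R :=
  minmodM M (q i - trace_plus v (i - 1)) (Delta_plus q i) (Delta_minus q i).

(* The + trace at x_{i+1/2} belongs to the cell i + 1. *)
Definition trace_limiter (M : R) (v : R -> R) (q : int -> R) : traces :=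
  Traces (fun i => q i + limited_right M v q i)
         (fun i => q (i + 1) - limited_left M v q (i + 1)).

(* z = Lambda(w) *)
Definition is_poly_limiter k bc (M : R) (w z : R -> R) : Prop :=
  let q := average w in
  let wt := trace_limiter M w q in
  Vh_bc k bc z /\
  forall i : int, 1 <= i <= N%:Z ->
    if (limited_right M w q i == trace_minus w i - q i) &&
       (limited_left M w q i == q i - trace_plus w (i - 1))
    then forall x, cell_int i x -> z x = w x
    else exists p : {poly R},
      [/\ (size p <= (minn k 2).+1)%N,
          forall x, cell_int i x -> z x = p.[x],
          average z i = average w i,
          trace_minus z i = tminus wt i &
          trace_plus z (i - 1) = tplus wt (i - 1)].

Definition explicit_RK s (A : 'M[R]_s) : Prop :=
  forall l j : 'I_s, (l <= j)%N -> A l j = 0.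

(* u' is obtained from u by one step of the trace-limited scheme: U are the
   stages, HU the predictor operator at the stages, FU the trace-limited
   corrector terms and w the unlimited update. *)
Definition trace_limited_step k bc (M : R) (f : R -> R) (fhat : R -> R -> R)
    (H : predictor) s (A : 'M[R]_s) (b : 'I_s -> R) (dt : R)
    (u u' : R -> R) : Prop :=
  exists (U HU FU : 'I_s -> R -> R) (w : R -> R),
  [/\ Vh_bc k bc u, (forall l, Vh_bc k bc (U l)) & Vh_bc k bc w] /\
  [/\ forall j, is_predictor H k bc f fhat (U j) (HU j),
      forall l, eqV (U l)
        (fun x => u x + dt * \sum_(j < s | (j < l)%N) A l j * HU j x),
      forall l, is_F_traces k bc f fhat (U l)
        (trace_limiter M (U l) (average u)) (FU l),
      eqV w (fun x => u x + dt * \sum_(l < s) b l * FU l x) &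
      is_poly_limiter k bc M w u'].

End DG.

(* Main.v *)
(* Testing the weak form with phi = 1 shows that the average of w on I_i is the
   convex combination, with weights b_l, of q_i - lambda (F^l_i - F^l_{i-1}),
   where q is the average of u and F^l the numerical flux at the limited traces
   of the l-th stage.  For M = 0 the minmod corrections lie between 0 and both
   neighbouring differences of q, so the increments of the limited traces are
   theta times a difference of q with 0 <= theta <= 2.  Each combined term is
   thus in Harten's incremental form with C + D <= 2 lambda (L1 + L2) <= 1, and
   the polynomial limiter does not change averages.  In the compactly supported
   case a polynomial that vanishes near the boundary vanishes on its whole
   cell, so q is zero on the first and last cells. *)
Require Import Defs.
From mathcomp Require Import all_boot all_order all_algebra.
From mathcomp Require Import all_classical all_reals all_analysis.
From mathcomp Require Import lra ring zify.
Set Implicit Arguments.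
Unset Strict Implicit.
Unset Printing Implicit Defensive.
Import Order.TTheory GRing.Theory Num.Theory.
Import numFieldNormedType.Exports.
Local Open Scope classical_set_scope.
Local Open Scope ring_scope.

(** * Minmod corrections and monotone flux increments *)

(** Stands for [x = theta * y] with [theta] in [0, 1]; the sign cases avoid division and suit linear
    arithmetic. *)
Definition between0 {R : realType} (y x : R) : Prop :=
  0 <= x <= y \/ y <= x <= 0.

Lemma minmodM0_between0 (R : realType) (T : mesh R) (a b c : R) :
  between0 b (minmodM T 0 a b c) /\ between0 c (minmodM T 0 a b c).
Proof.
rewrite /minmodM mul0r normr_le0.
have b0 x : between0 x 0 by rewrite /between0; lra.
(* For [M = 0] the branch that bypasses [minmod] is taken only at [a = 0], where it returns 0. *)
have [->|_] := eqVneq a 0; first by [].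
rewrite /minmod; case: ifP => [/andP[/eqP -> /eqP sbc]|_]; last by [].
set m := Order.min _ _.
have m0 : 0 <= m by rewrite !le_min !normr_ge0.
have scale x : m <= `|x| -> between0 x (Num.sg x * m).
  by rewrite /between0; case: (sgrP x) => x0 mx; lra.
split; last rewrite sbc; apply: scale.
  by rewrite !ge_min lexx orbT.
by rewrite !ge_min lexx !orbT.
Qed.

Lemma lipschitz_ge0 (R : realType) (L : R) (g : R -> R) :
  L.-lipschitz g -> 0 <= L.
Proof.
move=> /(_ (1, 0)) /(_ (conj I I)) /=; rewrite subr0 normr1 mulr1.
exact: le_trans (normr_ge0 _).
Qed.

(** Difference quotients of a nondecreasing [L]-Lipschitz function lie in [0, L]. No quotient is
    formed, since [y = x] is allowed. *)
Lemma flux_increment_between0 (R : realType) (lam L d x y : R) (g : R -> R) :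
  0 < lam -> {homo g : s t / s <= t} -> L.-lipschitz g ->
  between0 (2 * d) (y - x) ->
  between0 (lam * (2 * L) * d) (lam * (g y - g x)).
Proof.
move=> lam0 gmono glip.
have gL s t : `|g s - g t| <= L * `|s - t| by exact: (glip (s, t) (conj I I)).
have L0 := lipschitz_ge0 glip.
move=> [/andP[xy yx]|/andP[yx xy]]; [left|right].
- have gxy : g x <= g y by apply: gmono; lra.
  have := gL y x; rewrite !ger0_norm ?subr_ge0// => [gL'|]; last by lra.
  have h1 : g y - g x <= L * (2 * d).
    by apply: le_trans gL' _; rewrite ler_wpM2l.
  apply/andP; split; first by rewrite (mulr_ge0 (ltW lam0))// subr_ge0.
  rewrite -!mulrA (ler_pM2l lam0); lra.
- have gxy : g y <= g x by apply: gmono; lra.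
  have := gL x y; rewrite !ger0_norm ?subr_ge0// => [gL'|]; last by lra.
  have h1 : g x - g y <= L * (- (2 * d)).
    by apply: le_trans gL' _; rewrite ler_wpM2l//; lra.
  apply/andP; split; last by rewrite pmulr_rle0// subr_le0.
  rewrite -!mulrA (ler_pM2l lam0); lra.
Qed.

(** * Harten's incremental form *)

(** None of [x], [y] and [d - x - y] has the sign opposite to [d], so their absolute values add up
    exactly to that of [d]. *)
Lemma norm_sub_between0 (R : realType) (k1 k2 d x y : R) :
  0 <= k1 -> 0 <= k2 -> k1 + k2 <= 1 ->
  between0 (k1 * d) x -> between0 (k2 * d) y ->
  `|d - x - y| = `|d| - `|x| - `|y|.
Proof.
rewrite /between0 => k10 k20 k12 bx b_y.
have [d0|d0] := leP 0 d.
- have : (k1 + k2) * d <= 1 * d by rewrite ler_wpM2r.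
  have : 0 <= k1 * d by rewrite mulr_ge0.
  have : 0 <= k2 * d by rewrite mulr_ge0.
  by rewrite mulrDl mul1r => ? ? ?; rewrite !ger0_norm//; lra.
- have : 1 * d <= (k1 + k2) * d by rewrite ler_wnM2r// ltW.
  have : k1 * d <= 0 by rewrite mulr_ge0_le0// ltW.
  have : k2 * d <= 0 by rewrite mulr_ge0_le0// ltW.
  by rewrite mulrDl mul1r => ? ? ?; rewrite !ler0_norm//; lra.
Qed.

(* The outgoing parts [X], [Y] of the jump across an interface reappear in the
   neighbouring jumps, so their contributions telescope. *)
Lemma harten (R : realType) (n : nat) (q X Y W : int -> R) :
  (forall i : int, 1 <= i <= n.+1%:Z -> W i = q i + X i - Y (i - 1)) ->
  (forall i, `|q (i + 1) - q i - X i - Y i| =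
             `|q (i + 1) - q i| - `|X i| - `|Y i|) ->
  `|X (n%:Z + 1)| <= `|X 1| -> `|Y 0| <= `|Y n%:Z| ->
  \sum_(1 <= i < n.+1) `|W (i%:Z + 1) - W i%:Z| <=
  \sum_(1 <= i < n.+1) `|q (i%:Z + 1) - q i%:Z|.
Proof.
move=> WE bnd X1 Y0.
apply: (@le_trans _ _ (\sum_(1 <= i < n.+1) (`|q (i%:Z + 1) - q i%:Z|
   + (`|X i.+1%:Z| - `|X i%:Z|) - (`|Y i%:Z| - `|Y i.-1%:Z|)))).
  rewrite !big_nat; apply: ler_sum => -[//|i] /andP[_ ilt].
  rewrite !WE; [|lia..].
  have e1 : i.+1%:Z + 1 - 1 = i.+1%:Z by lia.
  have e2 : i.+1%:Z - 1 = i%:Z by lia.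
  have e3 : i.+1%:Z + 1 = i.+2%:Z by lia.
  have := bnd i.+1%:Z; rewrite e1 e2 e3 /=; set d := q _ - q _ => bd.
  set x := X i.+2%:Z.
  (* The jump of [W] keeps the remainder of its own jump and receives one outgoing part from each
     neighbouring interface. *)
  rewrite (_ : _ - (_ - _) = (d - X i.+1%:Z - Y i.+1%:Z) + x + Y i%:Z);
    last by rewrite /d /x; ring.
  apply: le_trans (ler_normD _ _) _.
  have := ler_normD (d - X i.+1%:Z - Y i.+1%:Z) x; rewrite bd; lra.
(* Telescoping leaves only end terms, whose total is nonpositive by the last two hypotheses. *)
rewrite sumrB big_split /=.
rewrite (telescope_sumr (fun i : nat => `|X i%:Z|))//.
have -> : \sum_(1 <= i < n.+1) (`|Y i%:Z| - `|Y i.-1%:Z|) = `|Y n%:Z| - `|Y 0|.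
  exact: (telescope_sumr (fun i : nat => `|Y i.-1%:Z|) (ltn0Sn n)).
have e : n%:Z + 1 = n.+1%:Z by lia.
move: X1; rewrite e => X1.
lra.
Qed.

(** The last hypothesis covers periodic data and data whose jumps just outside the summation range
    vanish; the end terms in [harten] then cancel or vanish. *)
Lemma limited_flux_tvd (R : realType) (n : nat) (fhat : R -> R -> R)
    (L1 L2 lam : R) (q r l W : int -> R) :
  monotone_flux fhat -> lipschitz_flux L1 L2 fhat ->
  0 < lam -> lam * (2 * (L1 + L2)) <= 1 ->
  (forall i, between0 (Delta_plus q i) (r i) /\
             between0 (Delta_minus q i) (r i)) ->
  (forall i, between0 (Delta_plus q i) (l i) /\
             between0 (Delta_minus q i) (l i)) ->
  let F i := fhat (q i + r i) (q (i + 1) - l (i + 1)) in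
  (forall i : int, 1 <= i <= n.+1%:Z -> W i = q i - lam * (F i - F (i - 1))) ->
  (forall i, q (i + n%:Z) = q i /\ r (i + n%:Z) = r i /\ l (i + n%:Z) = l i) \/
  (Delta_plus q 0 = 0 /\ Delta_plus q (n%:Z + 1) = 0) ->
  \sum_(1 <= i < n.+1) `|W (i%:Z + 1) - W i%:Z| <=
  \sum_(1 <= i < n.+1) `|q (i%:Z + 1) - q i%:Z|.
Proof.
move=> [mono1 mono2] [lip1 lip2] lam0 cfl rb lb F WE bc.
have L10 := lipschitz_ge0 (lip1 0).
have L20 := lipschitz_ge0 (lip2 0).
pose a i := q i + r i.
pose c i := q (i + 1) - l (i + 1).
(* Inserting [fhat (a i) (c (i - 1))], the flux at the two inner traces of cell [i], varies one
   argument at a time. The minus signs in [X] make the function of the second argument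
   nondecreasing. *)
pose X i := lam * (- fhat (a i) (c i) - - fhat (a i) (c (i - 1))).
pose Y i := lam * (fhat (a (i + 1)) (c i) - fhat (a i) (c i)).
have XB i : between0 (lam * (2 * L2) * Delta_plus q i) (X i).
  apply: (@flux_increment_between0 _ _ _ _ _ _ (fun t => - fhat (a i) t)) => //.
  - by move=> s t st; rewrite lerN2; exact: mono2.
  - move=> [s t] _ /=; rewrite -opprD normrN.
    exact: (lip2 (a i) (s, t) (conj I I)).
  (* The factor 2: [c i - c (i - 1)] is [Delta_plus q i - l (i + 1) + l i], and both corrections lie
     between 0 and that same jump. *)
  - rewrite /c subrK; have [_] := lb (i + 1); have [+ _] := lb i.
    by rewrite /between0 /Delta_plus /Delta_minus addrK; lra.
have YB i : between0 (lam * (2 * L1) * Delta_plus q i) (Y i).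
  apply: (@flux_increment_between0 _ _ _ _ _ _ (fun t => fhat t (c i))) => //.
  rewrite /a; have [_] := rb (i + 1); have [+ _] := rb i.
  by rewrite /between0 /Delta_plus /Delta_minus addrK; lra.
have zero k x : between0 (k * 0) x -> x = 0 :> R.
  by rewrite /between0 mulr0; lra.
apply: (@harten _ _ _ X Y).
- move=> i iN; rewrite WE// /F /X /Y subrK.
  have -> : q i - l i = c (i - 1) by rewrite /c subrK.
  by rewrite -/(a i) -/(a (i - 1)) -/(c i); ring.
- move=> i; apply: (@norm_sub_between0 _ (lam * (2 * L2)) (lam * (2 * L1))).
  + by rewrite !mulr_ge0// ltW.
  + by rewrite !mulr_ge0// ltW.
  + by lra.
  + exact: XB.
  + exact: YB.
- case: bc => [per|[_ d]]; last first.
    by have := XB (n%:Z + 1); rewrite d => /zero ->; rewrite normr0.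
  have ca i : a (i + n%:Z) = a i.
    by rewrite /a; have [-> [-> _]] := per i.
  have cc i : c (i + n%:Z) = c i.
    by rewrite /c addrAC; have [-> [_ ->]] := per (i + 1).
  have c0 : c n%:Z = c 0 by rewrite -(cc 0) add0r.
  by rewrite /X addrK subrr c0 (addrC n%:Z) ca cc.
- case: bc => [per|[d _]]; last first.
    by have := YB 0; rewrite d => /zero ->; rewrite normr0.
  have ca i : a (i + n%:Z) = a i.
    by rewrite /a; have [-> [-> _]] := per i.
  have cc i : c (i + n%:Z) = c i.
    by rewrite /c addrAC; have [-> [_ ->]] := per (i + 1).
  have a0 : a n%:Z = a 0 by rewrite -(ca 0) add0r.
  have c0 : c n%:Z = c 0 by rewrite -(cc 0) add0r.
  by rewrite /Y a0 c0 (addrC n%:Z) ca add0r.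
Qed.

(** * Averages and traces of piecewise polynomials *)

Lemma poly_primitive (R : realType) (p : {poly R}) : exists P, P^`() = p.
Proof.
exists (\poly_(i < (size p).+1) (p`_i.-1 / i%:R)).
apply/polyP => i; rewrite coef_deriv coef_poly ltnS.
case: ltnP => [_|sp]; last by rewrite mul0rn nth_default.
by rewrite /= -[LHS]mulr_natr divfK ?pnatr_eq0.
Qed.

Section Cells.
Context {R : realType} (T : mesh R).
Local Notation h := (cell_size T).
Local Notation N := (ncells T).

Lemma interface_lt (i : int) : interface T (i - 1) < interface T i.
Proof.
by rewrite /interface ltrD2l (ltr_pM2r (cell_size_gt0 T)) ltr_int; lia.
Qed.

(** Endpoints form a null set, so agreement on the open cell suffices for the fundamental theorem of
    calculus. Primitives turn later facts on averages into polynomial algebra. *)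
Lemma average_poly (v : R -> R) (i : int) (P : {poly R}) :
  (forall x, cell_int T i x -> v x = P^`().[x]) ->
  average T v i = h^-1 * (P.[interface T i] - P.[interface T (i - 1)]).
Proof.
move=> vP; have lt_if := interface_lt i.
rewrite /average; congr (_ * _); rewrite /Rintegral.
rewrite (@eq_integral_itv_bounded _ _ _ (horner P^`()) v).
- rewrite (@continuous_FTC2 _ _ (horner P))//.
  + exact/continuous_subspaceT/continuous_horner.
  + split=> [x _| |]; first exact: derivable_horner.
    * by apply: cvg_at_right_filter; exact: continuous_horner.
    * by apply: cvg_at_left_filter; exact: continuous_horner.
  + by move=> x _; rewrite derivE.
- apply: (@eq_measurable_fun _ _ _ _ _ (horner P^`())).
    by move=> x /set_mem /vP ->.
  exact: measurable_poly.
- exact: measurable_poly.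
- by move=> x xi; exact: vP.
Qed.

Lemma cell_int_shift (i : int) (x : R) :
  cell_int T i x -> cell_int T (i + N%:Z) (x + N%:R * h).
Proof.
by rewrite /cell_int /= !in_itv /= /interface addrAC !rmorphD /=; lra.
Qed.

Lemma trace_minus_poly (v : R -> R) (i : int) (p : {poly R}) :
  (forall x, cell_int T i x -> v x = p.[x]) ->
  trace_minus T v i = p.[interface T i].
Proof.
move=> vp; apply/cvg_lim => //.
have : p.[x] @[x --> (interface T i)^'-] --> p.[interface T i].
  by apply: cvg_at_left_filter; exact: continuous_horner.
apply: cvg_trans; apply: near_eq_cvg; near=> x; rewrite vp//.
rewrite /cell_int/= in_itv/=; apply/andP; split; near: x.
  exact/nbhs_left_gt/interface_lt.
exact: nbhs_left_lt.
Unshelve. all: by end_near. Qed.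

Lemma trace_plus_poly (v : R -> R) (i : int) (p : {poly R}) :
  (forall x, cell_int T i x -> v x = p.[x]) ->
  trace_plus T v (i - 1) = p.[interface T (i - 1)].
Proof.
move=> vp; apply/cvg_lim => //.
have : p.[x] @[x --> (interface T (i - 1))^'+] -->
    p.[interface T (i - 1)].
  by apply: cvg_at_right_filter; exact: continuous_horner.
apply: cvg_trans; apply: near_eq_cvg; near=> x; rewrite vp//.
rewrite /cell_int/= in_itv/=; apply/andP; split; near: x.
  exact: nbhs_right_gt.
exact/nbhs_right_lt/interface_lt.
Unshelve. all: by end_near. Qed.

Lemma eqV_average (v w : R -> R) (i : int) (k : nat) : Vh T k w ->
  (forall x, cell_int T i x -> v x = w x) -> average T v i = average T w i.
Proof.
move=> /(_ i)[p [_ wp]] vw; have [P dP] := poly_primitive p.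
rewrite !(@average_poly _ _ P)// => x xi; rewrite dP ?vw//; exact: wp.
Qed.

Lemma average_lincomb (k s : nat) (u w : R -> R) (dt : R) (b : 'I_s -> R)
    (g : 'I_s -> R -> R) (i : int) :
  Vh T k u -> (forall l, Vh T k (g l)) ->
  (forall x, cell_int T i x -> w x = u x + dt * \sum_(l < s) b l * g l x) ->
  average T w i = average T u i + dt * \sum_(l < s) b l * average T (g l) i.
Proof.
move=> /(_ i)[p [_ up]] Vg wE; have [P dP] := poly_primitive p.
have /choice[Q gQ] : forall l, exists Q : {poly R},
    forall x, cell_int T i x -> g l x = Q^`().[x].
  move=> l; have [r [_ gr]] := Vg l i; have [Q dQ] := poly_primitive r.
  by exists Q; rewrite dQ.
rewrite (@average_poly u _ P) ?dP//.
under [in RHS]eq_bigr => l _ do rewrite (@average_poly _ _ (Q l) (gQ l)).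
rewrite (@average_poly w _ (P + dt *: \sum_(l < s) b l *: Q l)).
  rewrite !hornerE !horner_sum.
  have hE y : \sum_(l < s) (b l *: Q l).[y] = \sum_(l < s) b l * (Q l).[y].
    by apply: eq_bigr => l _; rewrite hornerE.
  rewrite !hE; under [in RHS]eq_bigr => l _ do rewrite mulrCA mulrBr.
  rewrite -mulr_sumr sumrB; ring.
move=> x xi; rewrite wE// (up _ xi) derivD derivZ linear_sum !hornerE dP.
rewrite horner_sum; congr (_ + dt * _); apply: eq_bigr => l _.
by rewrite /= derivZ hornerE gQ.
Qed.

(** * Periodic extension *)

Section Periodic.
Context (v : R -> R) (vper : satisfies_bc T Periodic v).

Lemma periodic_poly (i : int) (p : {poly R}) :
  (forall x, cell_int T (i + N%:Z) x -> v x = p.[x]) ->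
  forall x, cell_int T i x -> v x = (p \Po ('X + (N%:R * h)%:P)).[x].
Proof.
move=> vp x xi; rewrite -(vper xi) vp; last exact: cell_int_shift.
by rewrite horner_comp !hornerE.
Qed.

Lemma interface_shift (i : int) :
  interface T i + N%:R * h = interface T (i + N%:Z).
Proof. by rewrite /interface rmorphD /=; ring. Qed.

Lemma periodic_average (k : nat) (i : int) : Vh T k v ->
  average T v (i + N%:Z) = average T v i.
Proof.
move=> /(_ (i + N%:Z))[p [_ vp]]; have [P dP] := poly_primitive p.
rewrite (@average_poly _ _ P) ?dP//.
rewrite (@average_poly _ i (P \Po ('X + (N%:R * h)%:P))).
  by rewrite !horner_comp !hornerE !interface_shift (addrAC i).
by rewrite deriv_comp derivD derivX derivC addr0 mulr1 dP; exact: periodic_poly.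
Qed.

Lemma periodic_trace_minus (k : nat) (i : int) : Vh T k v ->
  trace_minus T v (i + N%:Z) = trace_minus T v i.
Proof.
move=> /(_ (i + N%:Z))[p [_ vp]].
rewrite (trace_minus_poly vp) (trace_minus_poly (periodic_poly vp)).
by rewrite horner_comp !hornerE interface_shift.
Qed.

Lemma periodic_trace_plus (k : nat) (i : int) : Vh T k v ->
  trace_plus T v (i + N%:Z - 1) = trace_plus T v (i - 1).
Proof.
move=> /(_ (i + N%:Z))[p [_ vp]].
rewrite (trace_plus_poly vp) (trace_plus_poly (periodic_poly vp)).
by rewrite horner_comp !hornerE interface_shift (addrAC i).
Qed.

End Periodic.

(** * Compact support *)

Lemma poly_eq0_itv (p : {poly R}) (a b : R) : a < b ->
  (forall x, a < x < b -> p.[x] = 0) -> p = 0.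
Proof.
move=> ab p0; apply/eqP/negPn/negP => pn0.
(* These give [size p] distinct roots strictly inside the interval, too many for a nonzero [p];
   [j.+2] keeps [j = 0] off the endpoint [b]. *)
pose x j := a + (b - a) / j.+2%:R.
pose s := [seq x j | j <- iota 0 (size p)].
have := @max_poly_roots _ p s pn0; rewrite size_map size_iota ltnn => maxr.
suff : false by []; apply: maxr.
- apply/allP => _ /mapP[j _ ->]; apply/rootP/p0.
  have ba : 0 < b - a by lra.
  rewrite /x ltrDl divr_gt0//= -ltrBrDl ltr_pdivrMr//.
  by rewrite ltr_pMr// ltr1n.
- rewrite map_inj_uniq ?iota_uniq// => j l /addrI.
  move=> /(mulfI _); rewrite subr_eq0 gt_eqF// => /(_ isT)/invr_inj/eqP.
  by rewrite eqr_nat => /eqP[].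
Qed.

Lemma compact_average (k : nat) (v : R -> R) (i : int) : Vh T k v ->
  satisfies_bc T CompactSupport v -> i <= 1 \/ N%:Z <= i -> average T v i = 0.
Proof.
move=> /(_ i)[p [_ vp]] [d d0 vd] iN.
suff p0 : p = 0.
  rewrite (@average_poly _ _ 0) ?horner0 ?subr0 ?mulr0// => x xi.
  by rewrite deriv0 vp// p0.
have lti := interface_lt i; have h0 := cell_size_gt0 T.
case: iN => iN.
(* The minimum is needed because [d] may exceed the cell size; [i <= 1] puts the interval to the
   left of [left_end T + d]. *)
- apply: (@poly_eq0_itv _ (interface T (i - 1))
    (Num.min (interface T i) (interface T (i - 1) + d))).
    by rewrite lt_min lti ltrDl.
  move=> x; rewrite lt_min => /and3P[x1 x2 x3].
  have xi : cell_int T i x by rewrite /cell_int /= in_itv /= x1.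
  rewrite -vp// (vd i)//; left; apply: lt_le_trans x3 _; rewrite lerD2r.
  by rewrite /interface gerDl pmulr_lle0// lerz0; lia.
- apply: (@poly_eq0_itv _ (Num.max (interface T (i - 1)) (interface T i - d))
    (interface T i)).
    by rewrite gt_max lti ltrBlDr ltrDl.
  move=> x; rewrite gt_max => /andP[/andP[x1 x2] x3].
  have xi : cell_int T i x by rewrite /cell_int /= in_itv /= x1.
  rewrite -vp// (vd i)//; right; apply: le_lt_trans x2; rewrite lerD2r.
  by rewrite /right_end /interface lerD2l ler_pM2r// ler_int.
Qed.

(** * Evolution of the averages and the TVM bound *)

Lemma DG_average (k : nat) bc (f : R -> R) (Fr Fl : int -> R) (v g : R -> R)
    (i : int) : 1 <= i <= N%:Z -> DG_weak_form T k bc f Fr Fl v g ->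
  h * average T g i = - (Fr i - Fl i).
Proof.
move=> iN [_ /(_ (cst 1))].
have c1 (j : int) x : cell_int T j x -> cst 1 x = (1 : {poly R}).[x].
  by rewrite hornerE.
move=> /(_ _ i iN); rewrite (trace_minus_poly (c1 i)) (trace_plus_poly (c1 i)).
rewrite /average mulVKf ?gt_eqF ?cell_size_gt0// !hornerE.
under eq_Rintegral do rewrite mulr1.
under [X in X - _]eq_Rintegral do rewrite derive1_cst mulr0.
rewrite /Rintegral integral0 sub0r; apply => j.
exists 1; split => [|x]; first by rewrite size_poly1.
by move=> /c1.
Qed.

End Cells.

Lemma limiter_periodic (R : realType) (T : mesh R) (k : nat) (M : R)
    (u v : R -> R) (i : int) :
  Vh_bc T k Periodic u -> Vh_bc T k Periodic v ->
  limited_right T M v (average T u) (i + (ncells T)%:Z) =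
    limited_right T M v (average T u) i /\
  limited_left T M v (average T u) (i + (ncells T)%:Z) =
    limited_left T M v (average T u) i.
Proof.
move=> [uV uper] [vV vper].
have qper j := periodic_average uper j uV.
rewrite /limited_right /limited_left /Delta_plus /Delta_minus.
rewrite (periodic_trace_minus vper _ vV) (periodic_trace_plus vper _ vV).
by rewrite (addrAC i _ 1) (addrAC i _ (-1)) !qper.
Qed.

(** The range reaches the cell after the last one because [TVM] includes that jump; the limiter is
    prescribed only inside, so the boundary condition settles the extra cell. *)
Lemma poly_limiter_average (R : realType) (T : mesh R) (k : nat) bc (M : R)
    (w z : R -> R) (i : int) : Vh_bc T k bc w -> is_poly_limiter T k bc M w z ->
  1 <= i <= (ncells T)%:Z + 1 -> average T z i = average T w i.
Proof.
move=> [wV wbc] [[zV zbc] zw].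
have inner j : 1 <= j <= (ncells T)%:Z -> average T z j = average T w j.
  move=> /zw; case: ifP => [_ zwj|_ [p []]//]; exact: (eqV_average wV zwj).
have [iN|iN] := leP i (ncells T)%:Z; first by move=> i1; apply: inner; lia.
move=> i1; have {i1} -> : i = 1 + (ncells T)%:Z by lia.
have N0 := ncells_gt0 T.
case: bc wbc zbc {zw} => [wper zper|wc zc].
  by rewrite (periodic_average wper _ wV) (periodic_average zper _ zV)
       inner//; lia.
by rewrite (compact_average zV zc) ?(compact_average wV wc)//; lia.
Qed.

Theorem theorem4p4 (R : realType) (T : mesh R) (bc : boundary_condition)
  (k : nat) (f : R -> R) (fhat : R -> R -> R) (L1 L2 : R)
  (H : predictor) (s : nat) (A : 'M[R]_s) (b : 'I_s -> R) (dt : R)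
  (u u' : R -> R) :
  consistent f fhat ->
  monotone_flux fhat ->
  lipschitz_flux L1 L2 fhat ->
  explicit_RK A ->
  (forall l, 0 <= b l) ->
  \sum_(l < s) b l = 1 ->
  0 < dt ->
  let lambda := dt / cell_size T in
  (* lambda <= 1 / (2 (L1 + L2)), no restriction when L1 + L2 = 0 *)
  lambda * (2 * (L1 + L2)) <= 1 ->
  trace_limited_step T k bc 0 f fhat H A b dt u u' ->
  TVM T u' <= TVM T u.
Proof.
move=> _ mono lip _ b0 b1 dt0 lambda cfl.
move=> [U [HU [FU [w [[uV UV wV] [_ _ FUE wE limE]]]]]].
have h0 := cell_size_gt0 T.
have N0 := ncells_gt0 T.
set N := ncells T in N0.
pose q := average T u.
pose r l := limited_right T 0 (U l) q.
pose m l := limited_left T 0 (U l) q.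
pose F l i := fhat (q i + r l i) (q (i + 1) - m l (i + 1)).
have rB l i : between0 (Delta_plus q i) (r l i) /\
              between0 (Delta_minus q i) (r l i) by exact: minmodM0_between0.
have mB l i : between0 (Delta_plus q i) (m l i) /\
              between0 (Delta_minus q i) (m l i) by exact: minmodM0_between0.
have bdry :
    (forall l i, q (i + N%:Z) = q i /\ r l (i + N%:Z) = r l i /\
                 m l (i + N%:Z) = m l i) /\
    (forall l, average T (FU l) (1 + N%:Z) = average T (FU l) 1) \/
    (forall i, i <= 1 \/ N%:Z <= i -> q i = 0) /\
    (forall l, average T (FU l) (1 + N%:Z) = 0).
  case: bc uV UV FUE {wV limE} => uV UV FUE; [left|right]; split.
  - move=> l i; split; first by case: uV => uV uper;
      exact: (periodic_average uper).
    by rewrite /r /m /q; exact: (limiter_periodic 0 i uV (UV l)).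
  - by move=> l; case: (FUE l) => -[FV Fper] _; exact: (periodic_average Fper).
  - by move=> i; case: uV => uV uc; exact: compact_average.
  - move=> l; case: (FUE l) => -[FV Fc] _; apply: (compact_average FV Fc); lia.
(* The weak form is imposed only on the cells of the domain; the next cell is reduced to cell 1 by
   periodicity, or has both sides zero. *)
have avgFU l i : 1 <= i <= N%:Z + 1 ->
    cell_size T * average T (FU l) i = - (F l i - F l (i - 1)).
  move=> i1; have [iN|iN] := leP i N%:Z.
    by apply: DG_average (FUE l); lia.
  have {i1 iN} -> : i = 1 + N%:Z by lia.
  have one : 1 <= (1 : int) <= N%:Z by lia.
  case: bdry => [[per ->]|[q0 ->]].
    rewrite (DG_average one (FUE l)) -/N.
    have Fper j : F l (j + N%:Z) = F l j.
      rewrite /F addrAC; have [-> [-> _]] := per l j.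
      by have [-> [_ ->]] := per l (j + 1).
    by rewrite addrAC !Fper.
  rewrite mulr0 addrAC subrr add0r.
  (* Where [q] is flat the corrections are squeezed to 0, so the flux is constant even if the stages
     do not vanish. *)
  have F0 j : N%:Z <= j -> F l j = fhat 0 0.
    move=> jN; have qj : q j = 0 by apply: q0; lia.
    have qj1 : q (j + 1) = 0 by apply: q0; lia.
    have qj2 : q (j + 1 + 1) = 0 by apply: q0; lia.
    have [+ _] := rB l j; have [+ _] := mB l (j + 1).
    rewrite /F /Delta_plus qj qj1 qj2 subrr /between0 => m0 r0.
    have -> : r l j = 0 by lra.
    have -> : m l (j + 1) = 0 by lra.
    by rewrite addr0 subr0.
  by rewrite !F0 ?subrr ?oppr0//; lia.
pose W l i := q i - lambda * (F l i - F l (i - 1)).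
have avgu' i : 1 <= i <= N%:Z + 1 -> average T u' i = \sum_(l < s) b l * W l i.
  move=> i1; rewrite (poly_limiter_average wV limE)//.
  rewrite (average_lincomb (k := k) (u := u) (dt := dt) (b := b) (g := FU)).
  (* The weights sum to 1, so [q i] itself is distributed over the stages. *)
  - rewrite -[average T u i]mul1r -b1 mulr_suml mulr_sumr -big_split /=.
    apply: eq_bigr => l _; rewrite /W /lambda -[_ - F l (i - 1)]opprK -avgFU//.
    by rewrite /q; field; rewrite gt_eqF.
  - by case: uV.
  - by move=> l; case: (FUE l) => -[].
  - exact: wE.
have tvd l : \sum_(1 <= i < N.+1) `|W l (i%:Z + 1) - W l i%:Z| <= TVM T u.
  apply: (limited_flux_tvd mono lip _ cfl (rB l) (mB l)) => //.
    by rewrite divr_gt0.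
  case: bdry => [[per _]|[q0 _]]; [left; exact: per|right].
  by rewrite /Delta_plus !q0 ?subrr//; lia.
rewrite -[TVM T u]mul1r -b1 mulr_suml.
(* Convexity of the total variation: nonnegative weights, an exchange of sums and the triangle
   inequality. *)
apply: (le_trans _ (ler_sum _ (fun l _ => ler_wpM2l (b0 l) (tvd l)))).
under eq_bigr do rewrite mulr_sumr.
rewrite exchange_big /= /TVM !big_nat; apply: ler_sum => i iN.
rewrite !avgu' -/N; [|lia..].
rewrite -sumrB; apply: le_trans (ler_norm_sum _ _ _) _.
by apply: ler_sum => l _; rewrite -mulrBr normrM ger0_norm.
Qed.
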